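(* Let $m$ be an even positive integer, $n,l$ positive integers, and let $\mathcal{C}_1,\mathcal{C}_2,\ldots,\mathcal{C}_l$ be order $m$ dimension $n$ positive semi-definite symmetric Cauchy tensors. Then the Hadamard product $\mathcal{C}_1\circ\mathcal{C}_2\circ\cdots\circ\mathcal{C}_l$ is a positive semi-definite tensor.
   Context: $[n]=\{1,\ldots,n\}$. An order $m$ dimension $n$ symmetric Cauchy tensor with generating vector $c=(c_1,\ldots,c_n)\in\mathbb{R}^n$ is the real tensor $\mathcal{C}=(c_{i_1\cdots i_m})$ with entries $c_{i_1i_2\cdots i_m}=\frac{1}{c_{i_1}+c_{i_2}+\cdots+c_{i_m}}$, $i_1,\ldots,i_m\in[n]$, where it is assumed that $c_{i_1}+\cdots+c_{i_m}\neq 0$ for all $i_1,\ldots,i_m\in[n]$. The Hadamard product of order $m$ dimension $n$ tensors $\mathcal{A}=(a_{i_1\cdots i_m})$ and $\mathcal{B}=(b_{i_1\cdots i_m})$ is the entrywise product $\mathcal{A}\circ\mathcal{B}=(a_{i_1\cdots i_m}b_{i_1\cdots i_m})$. A tensor $\mathcal{A}$ of order $m$ and dimension $n$ is positive semi-definite if $\mathcal{A}x^m:=\sum_{i_1,\ldots,i_m\in[n]}a_{i_1\cdots i_m}x_{i_1}\cdots x_{i_m}\ge 0$ for all $x\in\mathbb{R}^n$. *)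

(* Defs.v *)
From mathcomp Require Import all_boot all_order all_algebra reals.

Set Implicit Arguments.
Unset Strict Implicit.
Unset Printing Implicit Defensive.

Import Order.TTheory GRing.Theory Num.Theory.

Local Open Scope ring_scope.

(* A multi-index (i_1, ..., i_m) is a finite function 'I_m -> 'I_n, so indices
   run over {0, ..., n-1} instead of {1, ..., n}. *)
Definition tensor (R : realType) (m n : nat) : Type :=
  {ffun {ffun 'I_m -> 'I_n} -> R}.

Definition cauchy_tensor (R : realType) (m n : nat) (c : 'rV[R]_n) :
    tensor R m n :=
  [ffun i : {ffun 'I_m -> 'I_n} => (\sum_(k < m) c 0 (i k))^-1].

(* The nonvanishing condition is part of the notion: without it, the convention
   0^-1 = 0 would admit spurious tensors. *)
Definition is_cauchy_tensor (R : realType) (m n : nat) (A : tensor R m n) :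
    Prop :=
  exists c : 'rV[R]_n,
    (forall i : {ffun 'I_m -> 'I_n}, \sum_(k < m) c 0 (i k) != 0) /\
    A = cauchy_tensor m c.

Definition hadamard (R : realType) (m n : nat) (A B : tensor R m n) :
    tensor R m n :=
  [ffun i : {ffun 'I_m -> 'I_n} => A i * B i].

(* The all-ones tensor is the unit of the Hadamard product; it only serves as
   the neutral element of the iterated product. *)
Definition hadamard1 (R : realType) (m n : nat) : tensor R m n :=
  [ffun _ : {ffun 'I_m -> 'I_n} => 1].

Definition tensor_form (R : realType) (m n : nat) (A : tensor R m n)
    (x : 'rV[R]_n) : R :=
  \sum_(i : {ffun 'I_m -> 'I_n}) A i * \prod_(k < m) x 0 (i k).

Definition psd_tensor (R : realType) (m n : nat) (A : tensor R m n) : Prop :=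
  forall x : 'rV[R]_n, 0 <= tensor_form A x.

(* Main.v *)
Require Import Defs.
From mathcomp Require Import all_boot all_order all_algebra reals.
From mathcomp Require Import ring.
From mathcomp Require Import classical_sets topology normedtype.
From mathcomp Require Import sequences derive.

(** Call a tensor A a multiplier if A ∘ B is positive semi-definite whenever B
is.  Rank-one tensors v^{⊗m} are multipliers, since (v^{⊗m} ∘ B) x^m = B (v x)^m
with v x the entrywise product, and multipliers form a closed convex cone.  A
positive semi-definite Cauchy tensor has a positive generating vector c, as one
sees by testing it on the unit vectors, and then it is a multiplier: for
v_t = (1 - t c_j)_j and small t > 0, the geometric series
  t sum_N (v_t^N)^{⊗m}
has entries t / (1 - prod_k (1 - t c_{i_k})), which tend to
1 / (c_{i_1} + ... + c_{i_m}) as t goes to 0.  Finally the all-ones tensor is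
positive semi-definite because m is even. *)

Set Implicit Arguments.
Unset Strict Implicit.
Unset Printing Implicit Defensive.

Import Order.TTheory GRing.Theory Num.Theory.
Import numFieldNormedType.Exports.

Local Open Scope ring_scope.

(** Exhibiting the quotient of [1 - \prod_i (1 - t * a i)] by [t] as a polynomial reduces its limit
    at 0 to continuity of polynomials. *)
Lemma one_sub_prod_horner (R : comNzRingType) (I : Type) (r : seq I) (a : I -> R) :
  exists2 p : {poly R}, p.[0] = \sum_(i <- r) a i &
    forall t, 1 - \prod_(i <- r) (1 - t * a i) = t * p.[t].
Proof.
elim: r => [|i r [p p0 pE]].
  by exists 0 => [|t]; rewrite ?horner0 big_nil ?subrr ?mulr0.
(* Comes from 1 - (1 - t a)(1 - t p) = t (a + p - a t p). *)
exists ((a i)%:P + p - (a i)%:P * (p * 'X)) => [|t].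
  rewrite big_cons !(hornerD, hornerN, hornerM, hornerC, hornerX) p0.
  by rewrite !mulr0 subr0.
rewrite big_cons -[X in _ * X](subKr 1) pE.
by rewrite !(hornerD, hornerN, hornerM, hornerC, hornerX); ring.
Qed.

(** Expand each [1 / (1 - q i)] as a geometric series: the sum is a limit of partial sums,
    nonnegative after exchanging the two finite sums. *)
Lemma geometric_sum_ge0 (R : realType) (I : finType) (b q : I -> R) :
  (forall i, `|q i| < 1) -> (forall N, 0 <= \sum_i b i * q i ^+ N) ->
  0 <= \sum_i b i / (1 - q i).
Proof.
move=> q_lt1 bq_ge0.
have bq_cvg : ((fun N => \sum_i b i * series (geometric 1 (q i)) N) @ \oo -->
    \sum_i b i / (1 - q i))%classic.
  apply: cvg_big => [|i _]; [exact: add_continuous|apply: cvgMl_tmp].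
  by rewrite -[_^-1]mul1r; exact: cvg_geometric_series.
apply: (cvgr_to_ge bq_cvg); apply: nearW => N.
under eq_bigr do rewrite /series /= mulr_sumr.
rewrite exchange_big sumr_ge0 // => k _.
by under eq_bigr do rewrite mul1r.
Qed.

Section Tensors.
Variables (R : realType) (m n : nat).
Implicit Types (B : tensor R m n) (x v c : 'rV[R]_n).

Lemma tensor_form_scale B v x :
  tensor_form B (\row_j (v 0 j * x 0 j)) =
  \sum_(i : {ffun 'I_m -> 'I_n})
    (B i * \prod_(k < m) x 0 (i k)) * \prod_(k < m) v 0 (i k).
Proof.
apply: eq_bigr => i _; under eq_bigr do rewrite mxE.
by rewrite big_split /= -mulrA [in RHS](mulrC (\prod_k x _ _)).
Qed.

Lemma tensor_form_delta B (j : 'I_n) :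
  tensor_form B (delta_mx 0 j) = B [ffun => j].
Proof.
rewrite /tensor_form (bigD1 [ffun => j]) //= [X in _ + X]big1 => [|i].
  by rewrite big1 ?mulr1 ?addr0 // => k _; rewrite ffunE mxE !eqxx.
move=> /eqP i_neq; have [k ik_neq] : exists k, i k != j.
  apply/existsP; rewrite -negb_forall; apply/negP => /forallP ij.
  by apply: i_neq; apply/ffunP => k; rewrite ffunE; exact/eqP.
by rewrite (bigD1 k) //= mxE (negPf ik_neq) andbF mul0r mulr0.
Qed.

(** The form at the unit vector e_j is the diagonal entry 1 / (m c_j). *)
Lemma psd_cauchy_gt0 c : (0 < m)%N ->
  (forall i : {ffun 'I_m -> 'I_n}, \sum_(k < m) c 0 (i k) != 0) ->
  psd_tensor (cauchy_tensor m c) -> forall j, 0 < c 0 j.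
Proof.
move=> m_gt0 c_neq0 /[swap] j /(_ (delta_mx 0 j)).
rewrite tensor_form_delta ffunE invr_ge0 le0r (negPf (c_neq0 _)) /=.
under eq_bigr do rewrite ffunE.
by rewrite sumr_const card_ord pmulrn_lgt0.
Qed.

Lemma psd_hadamard_cauchy c B : (0 < m)%N -> (forall j, 0 < c 0 j) ->
  psd_tensor B -> psd_tensor (hadamard (cauchy_tensor m c) B).
Proof.
move=> m_gt0 c_gt0 B_psd x.
pose b (i : {ffun 'I_m -> 'I_n}) := B i * \prod_(k < m) x 0 (i k).
pose q t (i : {ffun 'I_m -> 'I_n}) := \prod_(k < m) (1 - t * c 0 (i k)).
have s_gt0 (i : {ffun 'I_m -> 'I_n}) : 0 < \sum_(k < m) c 0 (i k).
  case: m m_gt0 i => // m' _ i; rewrite big_ord_recl ltr_wpDr //.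
  by apply: sumr_ge0 => k _; exact: ltW.
(* This sum is the form of [B] at the vector with entries (1 - t c_j)^N x_j. *)
have bq_ge0 t N : 0 <= \sum_i b i * q t i ^+ N.
  have := B_psd (\row_j ((\row_j (1 - t * c 0 j) ^+ N) 0 j * x 0 j)).
  rewrite tensor_form_scale; congr (0 <= _); apply: eq_bigr => i _.
  by rewrite -prodrXl; congr (_ * _); apply: eq_bigr => k _; rewrite mxE.
have /fin_all_exists2 [p p0 pE] (i : {ffun 'I_m -> 'I_n}) :=
  one_sub_prod_horner (index_enum 'I_m) (fun k => c 0 (i k)).
have -> : tensor_form (hadamard (cauchy_tensor m c) B) x =
    \sum_i b i / (p i).[0].
  by apply: eq_bigr => i _; rewrite p0 !ffunE -mulrA mulrC.
have bp_cvg : ((fun t => \sum_i b i / (p i).[t]) @ 0^'+ -->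
    \sum_i b i / (p i).[0])%classic.
  apply: cvg_big => [|i _]; [exact: add_continuous|apply: cvgMl_tmp].
  apply: cvgV; first by rewrite p0 gt_eqF.
  by apply: cvg_at_right_filter; exact: continuous_horner.
apply: (cvgr_to_ge bp_cvg).
(* [M] exceeds every c_j, so 0 < t < 1/M puts each 1 - t c_j strictly between 0 and 1. *)
pose M := 1 + \sum_j c 0 j.
have c_ltM j : c 0 j < M.
  rewrite /M (bigD1 j) //= addrCA ltrDl ltr_wpDr //.
  by apply: sumr_ge0 => k _; exact: ltW.
have M_gt0 : 0 < M by rewrite ltr_wpDr // sumr_ge0 // => k _; exact: ltW.
near=> t.
have t_gt0 : 0 < t by near: t; exact: nbhs_right_gt.
have tM_lt1 : t < M^-1 by near: t; apply: nbhs_right_lt; rewrite invr_gt0.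
have v_gt0 j : 0 < 1 - t * c 0 j.
  rewrite subr_gt0 -(mulVf (lt0r_neq0 M_gt0)).
  by apply: ltr_pM => //; exact: ltW.
have v_lt1 j : 1 - t * c 0 j < 1 by rewrite gtrBl mulr_gt0.
have q_lt1 i : `|q t i| < 1.
  rewrite ger0_norm; last by apply: prodr_ge0 => k _; exact: ltW.
  (* As [m > 0], there is a first factor, which is below 1; the others are at most 1. *)
  rewrite /q; case: (m) m_gt0 i => // m' _ i; rewrite big_ord_recl.
  apply: le_lt_trans (v_lt1 (i ord0)); apply: ler_piMr; first exact: ltW.
  by apply: prodr_ile1 => k _; rewrite !ltW.
have bp_E i : b i / (p i).[t] = t * (b i / (1 - q t i)).
  by rewrite pE invfM mulrCA mulVKf ?gt_eqF.
under eq_bigr do rewrite bp_E.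
rewrite -mulr_sumr; apply: mulr_ge0; [exact: ltW|exact: geometric_sum_ge0].
Unshelve. all: by end_near.
Qed.

End Tensors.

Theorem corollary2p5 (R : realType) (m n l : nat)
  (m_gt0 : (0 < m)%N) (m_even : ~~ odd m)
  (n_gt0 : (0 < n)%N) (l_gt0 : (0 < l)%N)
  (C : 'I_l -> tensor R m n)
  (C_cauchy : forall k : 'I_l, is_cauchy_tensor (C k))
  (C_psd : forall k : 'I_l, psd_tensor (C k)) :
  psd_tensor (\big[@hadamard R m n/@hadamard1 R m n]_(k < l) C k).
Proof.
apply: (big_rec (fun A => psd_tensor A)) => [x|k B _ B_psd].
  rewrite /tensor_form; under eq_bigr do rewrite ffunE mul1r.
  (* The form of the all-ones tensor is (x_1 + ... + x_n)^m, an even power. *)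
  rewrite -(bigA_distr_bigA (fun _ => x 0)) prodr_const card_ord.
  by rewrite exprn_even_ge0.
have [c [c_neq0 CE]] := C_cauchy k.
rewrite CE; apply: psd_hadamard_cauchy => //; apply: (psd_cauchy_gt0 m_gt0) => //.
by rewrite -CE.
Qed.
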